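(* Let $A,B,C$ be real matrices of sizes $n\times n$, $n\times r$, $r\times n$ with $\operatorname{rank}B=\operatorname{rank}C=r$, $(A,B)$ controllable, and $P(s)=\begin{bmatrix}sI_n-A&-B\\C&O\end{bmatrix}$ of normal rank $n+r$. Let $\nu$ be the controllability index of $(A,B)$ and $l_{\nu-1}=\operatorname{rank}[B,AB]-\operatorname{rank}B$. The number of system zeros (counted with multiplicity) of $\dot x=Ax+Bu$, $y=Cx$ satisfies: 1. if $\operatorname{rank}(CB)=r$, the system has exactly $n-r$ zeros; 2. if $CB$ has rank deficiency $d$ (i.e. $\operatorname{rank}(CB)=r-d$), the system has no more than $n-r-d$ zeros; 3. if $CB=O$, then: 3.1. if $l_{\nu-1}=r$ and $\operatorname{rank}(CAB)=r$, the system has exactly $n-2r$ zeros; 3.2. if $l_{\nu-1}=r$ and $\operatorname{rank}(CAB)<r$ with rank deficiency $\bar d=r-\operatorname{rank}(CAB)<r$, the system has no more than $n-2r-\bar d$ zeros; 3.3. if $l_{\nu-1}<r$ and $\operatorname{rank}(CAB)=l_{\nu-1}$, the system has no more than $n-3r+l_{\nu-1}$ zeros; 3.4. if $l_{\nu-1}<r$ and $\operatorname{rank}(CAB)<l_{\nu-1}$ with rank deficiency $\bar d=l_{\nu-1}-\operatorname{rank}(CAB)$, the system has no more than $n-3r+l_{\nu-1}-\bar d$ zeros.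
   Context: The controllability index of $(A,B)$ is the smallest $\nu$ with $\operatorname{rank}[B,AB,\dots,A^{\nu-1}B]=\operatorname{rank}[B,\dots,A^{n-1}B]$. In this square case the system zeros are the zeros of the polynomial $\det P(s)$, which by the normal rank assumption is not identically zero. *)

(* Defs.v *)
From HB Require Import structures.
From mathcomp Require Import all_boot all_order all_algebra.
From mathcomp Require Import reals complex.

Set Implicit Arguments.
Unset Strict Implicit.
Unset Printing Implicit Defensive.

Import GRing.Theory.
Local Open Scope ring_scope.

Definition ctrb_mx (F : fieldType) (n r k : nat) (A : 'M[F]_n)
    (B : 'M[F]_(n, r)) : 'M[F]_(n, \sum_(j < k) r) :=
  \mxrow_(j < k) (A ^+ j *m B).

Definition controllable (F : fieldType) (n r : nat) (A : 'M[F]_n)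
    (B : 'M[F]_(n, r)) : Prop :=
  \rank (ctrb_mx n A B) = n.

Lemma controllability_index_subproof (F : fieldType) (n r : nat)
    (A : 'M[F]_n) (B : 'M[F]_(n, r)) :
  exists k, \rank (ctrb_mx k A B) == \rank (ctrb_mx n A B).
Proof. by exists n. Qed.

Definition controllability_index (F : fieldType) (n r : nat) (A : 'M[F]_n)
    (B : 'M[F]_(n, r)) : nat :=
  ex_minn (controllability_index_subproof A B).

Definition system_mx (F : fieldType) (n r : nat) (A : 'M[F]_n)
    (B : 'M[F]_(n, r)) (C : 'M[F]_(r, n)) : 'M[{poly F}]_(n + r) :=
  block_mx ('X%:M - map_mx polyC A) (- map_mx polyC B)
           (map_mx polyC C)         0.

(* Rank over the field of rational functions. *)
Definition normal_rank (F : fieldType) (m p : nat) (M : 'M[{poly F}]_(m, p)) :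
    nat :=
  \rank (map_mx (@tofrac _) M).

(* The complex zeros of p, each repeated according to its multiplicity (see
   [count_poly_zeros]); only meaningful for p != 0. *)
Definition poly_zeros (R : realType) (p : {poly R}) : seq R[i] :=
  sval (closed_field_poly_normal (map_poly (real_complex R) p)).

Lemma count_poly_zeros (R : realType) (p : {poly R}) (z : R[i]) : p != 0 ->
  count_mem z (poly_zeros p) = mup z (map_poly (real_complex R) p).
Proof.
rewrite /poly_zeros; case: closed_field_poly_normal => s /= eq_p p_neq0.
have lc_neq0 : lead_coef (map_poly (real_complex R) p) != 0.
  by rewrite lead_coef_eq0 map_poly_eq0.
rewrite [in RHS]eq_p -mul_polyC mupMr ?mu_prod_XsubC //.
by rewrite /root hornerC.
Qed.

Definition system_zeros (R : realType) (n r : nat) (A : 'M[R]_n)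
    (B : 'M[R]_(n, r)) (C : 'M[R]_(r, n)) : seq R[i] :=
  poly_zeros (\det (system_mx A B C)).

Definition nb_system_zeros (R : realType) (n r : nat) (A : 'M[R]_n)
    (B : 'M[R]_(n, r)) (C : 'M[R]_(r, n)) : nat :=
  size (system_zeros A B C).

(* Main.v *)
(* Write T(K, L) for the determinant of [[sI - A, -B]; [K, L]].  Multiplying the
   last r rows of P(s) by s and subtracting C (sI - A | -B) gives
   s^r det P(s) = T(CA, CB); when CB = 0 the right-hand side is the determinant
   of the system matrix of (A, B, CA), so the step can be repeated and
   s^(2r) det P(s) = T(CA^2, CAB).  For constant K and L, T(K, L) has degree at
   most n and its coefficient of s^n is det L, so the degree is n when L is
   invertible.  If L has rank deficiency d, a constant row operation makes d
   rows of L vanish; those rows can be multiplied by s and reduced to constants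
   in the same way, hence deg T(K, L) <= n - d. *)

Require Import Defs.
From HB Require Import structures.
From mathcomp Require Import all_boot all_order all_algebra.
From mathcomp Require Import reals complex.
From mathcomp Require Import perm zify.

Set Implicit Arguments.
Unset Strict Implicit.
Unset Printing Implicit Defensive.

Import Order.TTheory GRing.Theory Num.Theory.
Local Open Scope ring_scope.

(** In the convolution sum only the index [a] survives: above it the coefficient of [p] vanishes,
    below it that of [q] does. *)
Lemma coefM_size_le (R : nzRingType) (p q : {poly R}) (a b : nat) :
  (size p <= a.+1)%N -> (size q <= b.+1)%N -> (p * q)`_(a + b) = p`_a * q`_b.
Proof.
move=> le_p le_q; have lt_a : (a < (a + b).+1)%N by rewrite ltnS leq_addr.
rewrite coefM (bigD1 (Ordinal lt_a)) //= addKn big1 ?addr0 // => j ne_j.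
have [lt_aj|le_ja] := ltnP a j.
  by rewrite nth_default ?mul0r // (leq_trans le_p).
have lt_ja : (j < a)%N by rewrite ltn_neqAle le_ja andbT.
by rewrite [X in _ * X]nth_default ?mulr0 // (leq_trans le_q) //; lia.
Qed.

Lemma coef_prod_size_le (R : comNzRingType) (I : Type) (s : seq I) (P : pred I)
    (p : I -> {poly R}) (d : I -> nat) :
    (forall i, P i -> (size (p i) <= (d i).+1)%N) ->
  (size (\prod_(i <- s | P i) p i)%R
     <= (\sum_(i <- s | P i) d i).+1)%N /\
  (\prod_(i <- s | P i) p i)`_(\sum_(i <- s | P i) d i)
    = \prod_(i <- s | P i) (p i)`_(d i).
Proof.
move=> le_pd.
elim: s => [|i s [IHs IHc]]; first by rewrite !big_nil size_poly1 coefC.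
rewrite !big_cons; case: ifP => // Pi; have le_pi := le_pd i Pi; split.
  by apply: leq_trans (size_polyMleq _ _) _; lia.
by rewrite coefM_size_le // IHc.
Qed.

(** Each Leibniz term takes one entry per row, so the row degree bounds add up, and the top
    coefficients form the Leibniz expansion of the matrix of row-leading coefficients. *)
Lemma coef_det_row_size_le (R : comNzRingType) (m : nat)
    (M : 'M[{poly R}]_m) (d : 'I_m -> nat) :
    (forall i j, (size (M i j) <= (d i).+1)%N) ->
  (size (\det M) <= (\sum_i d i).+1)%N /\
  (\det M)`_(\sum_i d i) = \det (\matrix_(i, j) (M i j)`_(d i)).
Proof.
move=> le_Md.
have prodP (s : 'S_m) := coef_prod_size_le (P := xpredT)
  (index_enum 'I_m) (fun i _ => le_Md i (s i)).
split.
  apply: (leq_trans (size_sum _ _ _)); apply/bigmax_leqP => s _.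
  have [le_s _] := prodP s.
  by rewrite mulr_sign; case: ifP => _; rewrite ?size_polyN.
rewrite coef_sum; apply: eq_bigr => s _.
have [_ coef_s] := prodP s.
under [in RHS]eq_bigr do rewrite mxE.
by rewrite !mulr_sign; case: ifP => _; rewrite ?coefN coef_s.
Qed.

Section Pencil.

Variables (F : fieldType) (n r : nat) (A : 'M[F]_n) (B : 'M[F]_(n, r)).

(** Its determinant is T(K, L). The lower blocks may be polynomial because rows multiplied by ['X]
    occur before they are reduced to constants. *)
Definition pencil (K : 'M[{poly F}]_(r, n)) (L : 'M[{poly F}]_r) :=
  block_mx ('X%:M - map_mx polyC A) (- map_mx polyC B) K L.

Lemma det_pencil_row_op (Y K : 'M[{poly F}]_(r, n)) (L : 'M[{poly F}]_r) :
  \det (pencil (K + Y *m ('X%:M - map_mx polyC A)) (L - Y *m map_mx polyC B))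
    = \det (pencil K L).
Proof.
have -> : pencil (K + Y *m ('X%:M - map_mx polyC A))
    (L - Y *m map_mx polyC B) = block_mx 1%:M 0 Y 1%:M *m pencil K L.
  rewrite /pencil mulmx_block !mul1mx !mul0mx !addr0 mulmxN.
  by rewrite [K + _]addrC [L - _]addrC.
by rewrite det_mulmx det_lblock !det1 !mul1r.
Qed.

Lemma det_pencil_mull (D : 'M[{poly F}]_r) (K : 'M[{poly F}]_(r, n))
    (L : 'M[{poly F}]_r) :
  \det (pencil (D *m K) (D *m L)) = \det D * \det (pencil K L).
Proof.
have -> : pencil (D *m K) (D *m L) = block_mx 1%:M 0 0 D *m pencil K L.
  by rewrite /pencil mulmx_block !mul1mx !mul0mx !addr0 !add0r.
by rewrite det_mulmx det_lblock det1 mul1r.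
Qed.

(** The first [n] rows have degree at most 1 and the last [r] degree 0; the row-leading coefficients
    form the block matrix [[I, 0], [K, L]], of determinant det L. *)
Lemma det_pencil_const (K : 'M[F]_(r, n)) (L : 'M[F]_r) :
  let p := \det (pencil (map_mx polyC K) (map_mx polyC L)) in
  (size p <= n.+1)%N /\ p`_n = \det L.
Proof.
move=> p.
pose d (i : 'I_(n + r)) := if split i is inl _ then 1%N else 0%N.
have sum_d : (\sum_i d i)%N = n.
  rewrite big_split_ord /= [X in (X + _)%N](eq_bigr (fun=> 1%N)); last first.
    by move=> i _; rewrite /d (unsplitK (inl i)).
  rewrite [X in (_ + X)%N]big1 ?addn0 ?sum1_card ?card_ord // => i _.
  by rewrite /d (unsplitK (inr i)).
have le_d i j : (size (pencil (map_mx polyC K) (map_mx polyC L) i j)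
    <= (d i).+1)%N.
  rewrite /d /pencil mxE; case: splitP => i' _ /=; rewrite mxE;
    case: splitP => j' _; rewrite !mxE ?size_polyN;
    try by rewrite (leq_trans (size_polyC_leq1 _)).
  case: eqP => _; rewrite ?mulr1n ?mulr0n ?size_XsubC //.
  by rewrite sub0r size_polyN (leq_trans (size_polyC_leq1 _)).
have [] := coef_det_row_size_le le_d; rewrite sum_d => le_p coef_p.
split=> //; rewrite /p coef_p.
suff -> : \matrix_(i, j) (pencil (map_mx polyC K) (map_mx polyC L) i j)`_(d i)
    = block_mx 1%:M 0 K L by rewrite det_lblock det1 mul1r.
apply/matrixP => i j; rewrite /d /pencil !mxE.
case: splitP => i' _ /=; rewrite !mxE; case: splitP => j' _ /=;
  rewrite !mxE ?coefN ?coefC //= ?oppr0 //.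
rewrite coefB coefC subr0.
by case: eqP => _; rewrite ?mulr1n ?mulr0n ?coefX ?coef0.
Qed.

Lemma det_pencil_scaleX (C : 'M[F]_(r, n)) :
  'X^r * \det (pencil (map_mx polyC C) 0)
    = \det (pencil (map_mx polyC (C *m A)) (map_mx polyC (C *m B))).
Proof.
rewrite -det_scalar -det_pencil_mull mulmx0.
(* The lower blocks become sC - C(sI - A) = CA and 0 + CB. *)
rewrite -(det_pencil_row_op (- map_mx polyC C)) mulmxBr !mulNmx !opprK add0r.
by rewrite mul_mx_scalar mul_scalar_mx addrA subrr add0r -!map_mxM.
Qed.

Lemma size_det_pencil_le (K : 'M[F]_(r, n)) (L : 'M[F]_r) :
  let p := \det (pencil (map_mx polyC K) (map_mx polyC L)) in
  p != 0 -> (size p + (r - \rank L) <= n.+1)%N.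
Proof.
move=> p p_neq0; set k := \rank L.
(* Since L is [col_ebase L] times [pid_mx k] times [row_ebase L], the last r - k rows of UL vanish;
   [E] keeps exactly those rows. *)
pose U := invmx (col_ebase L); pose E : 'M[F]_r := copid_mx k.
have U_unit : \det U != 0.
  by rewrite -unitfE -unitmxE unitmx_inv col_ebase_unit.
have EUL : E *m (U *m L) = 0.
  rewrite -{1}[L]mulmx_ebase !mulmxA.
  rewrite -[E *m U *m col_ebase L]mulmxA mulVmx ?col_ebase_unit // mulmx1.
  by rewrite mul_copid_mx_pid ?mul0mx // rank_leq_row.
pose cE : 'M[{poly F}]_r := map_mx polyC E.
(* [D] fixes the first k rows and multiplies the other r - k by ['X]. *)
pose D := map_mx polyC (pid_mx k : 'M[F]_r) + 'X *: cE.
have detD : \det D = 'X^(r - k).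
  have -> : D = diag_mx (\row_i (if (i < k)%N then 1 else 'X)).
    apply/matrixP => i j; rewrite !mxE.
    case: (eqVneq i j) => [<-|ne_ij] /=; last first.
      rewrite (negPf (ne_ij : i != j :> nat)) /= !mulr0n.
      by rewrite subr0 polyC0 mulr0 addr0.
    rewrite eqxx /=; case: ltnP => _; rewrite ?mulr1n ?mulr0n.
      by rewrite subrr polyC0 mulr0 addr0 polyC1.
    by rewrite subr0 polyC1 polyC0 mulr1 add0r.
  rewrite det_diag; under eq_bigr do rewrite mxE.
  rewrite -(big_mkord xpredT (fun i => if (i < k)%N then 1 else 'X)) /=.
  rewrite (@big_cat_nat _ _ _ k) ?rank_leq_row //= big_nat_cond big1 ?mul1r.
    rewrite big_nat_cond (eq_bigr (fun=> 'X)) => [|i].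
      by rewrite -big_nat_cond prodr_const_nat.
    by rewrite andbT => /andP[le_ki _]; rewrite ltnNge le_ki.
  by move=> i; rewrite andbT => /andP[_ ->].
(* The left block of the scaled rows contains sM; subtracting M times the first block row turns it
   into MA and adds MB on the right, so all lower blocks are constant again. *)
pose M := E *m (U *m K).
pose q := \det (pencil (map_mx polyC (pid_mx k *m (U *m K) + M *m A))
                       (map_mx polyC (pid_mx k *m (U *m L) + M *m B))).
have Dq : 'X^(r - k) * ((\det U)%:P * p) = q.
  rewrite -detD -det_map_mx -!det_pencil_mull -!map_mxM.
  rewrite -(det_pencil_row_op (- map_mx polyC M)) /D !mulmxDl -!scalemxAl.
  rewrite -!map_mxM EUL map_mx0 scaler0 addr0 mulmxBr !mulNmx !opprK.
  rewrite mul_mx_scalar -!map_mxM -/M addrA addrK.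
  by rewrite /q !map_mxD.
have [le_q _] : (size q <= n.+1)%N /\ q`_n = _ := det_pencil_const _ _.
move: le_q; rewrite -Dq mulrC size_mulXn ?mulf_neq0 ?polyC_eq0 //.
by rewrite mul_polyC size_scale // addnC.
Qed.

End Pencil.

Lemma system_mx_pencil (F : fieldType) (n r : nat) (A : 'M[F]_n)
    (B : 'M[F]_(n, r)) (C : 'M[F]_(r, n)) :
  system_mx A B C = pencil A B (map_mx polyC C) 0.
Proof. by []. Qed.

Lemma size_det_system_mx (F : fieldType) (n r : nat) (A : 'M[F]_n)
    (B : 'M[F]_(n, r)) (C : 'M[F]_(r, n)) :
    let p := \det (system_mx A B C) in p != 0 ->
  (size p + r + (r - \rank (C *m B)) <= n.+1)%N /\
  (\rank (C *m B) = r -> (size p + r)%N = n.+1).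
Proof.
move=> p p_neq0; have pX := det_pencil_scaleX A B C.
have size_pX : size ('X^r * p) = (size p + r)%N.
  by rewrite mulrC size_mulXn // addnC.
have pX_neq0 : 'X^r * p != 0 by rewrite mulf_neq0 // expf_neq0 ?polyX_eq0.
rewrite -size_pX /p system_mx_pencil pX in pX_neq0 *.
split=> [|full]; first exact: size_det_pencil_le.
have [le_n coef_n] := det_pencil_const A B (C *m A) (C *m B).
(* A smaller size would make the coefficient of degree [n], which is det(CB), vanish, against the
   full rank of CB. *)
apply/eqP; rewrite eqn_leq le_n ltnNge.
apply/negP => /leq_sizeP/(_ n (leqnn n)).
rewrite coef_n => det0; have : C *m B \in unitmx.
  by rewrite -row_free_unit /row_free full.
by rewrite unitmxE det0 unitr0.
Qed.

Lemma det_system_mx_shift (F : fieldType) (n r : nat) (A : 'M[F]_n)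
    (B : 'M[F]_(n, r)) (C : 'M[F]_(r, n)) : C *m B = 0 ->
  \det (system_mx A B (C *m A)) = 'X^r * \det (system_mx A B C).
Proof.
by move=> CB0; rewrite !system_mx_pencil det_pencil_scaleX CB0 map_mx0.
Qed.

(** The previous size estimate is applied to (A, B, CA): one [r] comes from that estimate, the other
    from the factor ['X^r] relating the two determinants. *)
Lemma size_det_system_mx_shift (F : fieldType) (n r : nat) (A : 'M[F]_n)
    (B : 'M[F]_(n, r)) (C : 'M[F]_(r, n)) :
    let p := \det (system_mx A B C) in p != 0 -> C *m B = 0 ->
  (size p + 2 * r + (r - \rank (C *m A *m B)) <= n.+1)%N /\
  (\rank (C *m A *m B) = r -> (size p + 2 * r)%N = n.+1).
Proof.
move=> p p_neq0 CB0; have shift := det_system_mx_shift A CB0.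
have : \det (system_mx A B (C *m A)) != 0.
  by rewrite shift mulf_neq0 // expf_neq0 ?polyX_eq0.
move=> /size_det_system_mx; rewrite shift mulrC size_mulXn // -/p.
by rewrite [(r + _)%N]addnC -[(size p + r + r)%N]addnA addnn -mul2n.
Qed.

Lemma det_neq0_normal_rank (F : fieldType) (m : nat) (M : 'M[{poly F}]_m) :
  normal_rank M = m -> \det M != 0.
Proof.
move=> full; have : map_mx (@tofrac _) M \in unitmx.
  by rewrite -row_free_unit /row_free -[X in _ == X]full.
by rewrite unitmxE det_map_mx unitfE tofrac_eq0.
Qed.

Lemma size_poly_zeros (R : realType) (p : {poly R}) :
  p != 0 -> size (poly_zeros p) = (size p).-1.
Proof.
rewrite /poly_zeros; case: closed_field_poly_normal => s /= eq_p p_neq0.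
rewrite -(size_map_poly (real_complex R) p) eq_p size_scale ?size_prod_XsubC //.
by rewrite lead_coef_eq0 map_poly_eq0.
Qed.

Theorem theorem7p5 (R : realType) (n r : nat)
    (A : 'M[R]_n) (B : 'M[R]_(n, r)) (C : 'M[R]_(r, n))
    (rankB : \rank B = r) (rankC : \rank C = r)
    (ctrAB : controllable A B)
    (nrankP : normal_rank (system_mx A B C) = (n + r)%N)
    (nu : nat) (nuE : nu = controllability_index A B)
    (l : nat -> nat)
    (lE : l (nu - 1)%N = (\rank (row_mx B (A *m B)) - \rank B)%N) :
  [/\ \rank (C *m B) = r ->
        (nb_system_zeros A B C)%:Z = n%:Z - r%:Z,
      forall d : nat, (d <= r)%N -> \rank (C *m B) = (r - d)%N ->
        (nb_system_zeros A B C)%:Z <= n%:Z - r%:Z - d%:Z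
    & C *m B = 0 ->
      [/\ l (nu - 1)%N = r -> \rank (C *m A *m B) = r ->
            (nb_system_zeros A B C)%:Z = n%:Z - 2%:Z * r%:Z,
          forall dbar : nat,
            l (nu - 1)%N = r -> (\rank (C *m A *m B) < r)%N ->
            dbar = (r - \rank (C *m A *m B))%N -> (dbar < r)%N ->
            (nb_system_zeros A B C)%:Z <= n%:Z - 2%:Z * r%:Z - dbar%:Z,
          (l (nu - 1)%N < r)%N -> \rank (C *m A *m B) = l (nu - 1)%N ->
            (nb_system_zeros A B C)%:Z
              <= n%:Z - 3%:Z * r%:Z + (l (nu - 1)%N)%:Z
        & forall dbar : nat,
            (l (nu - 1)%N < r)%N ->
            (\rank (C *m A *m B) < l (nu - 1)%N)%N ->
            dbar = (l (nu - 1)%N - \rank (C *m A *m B))%N ->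
            (nb_system_zeros A B C)%:Z
              <= n%:Z - 3%:Z * r%:Z + (l (nu - 1)%N)%:Z - dbar%:Z]].
Proof.
have p_neq0 := det_neq0_normal_rank nrankP.
have p_gt0 : (0 < size (\det (system_mx A B C)))%N by rewrite size_poly_gt0.
rewrite /nb_system_zeros /system_zeros size_poly_zeros //.
(* The number of zeros is now [(size p).-1]; positivity of the size makes the predecessor exact, and
   what remains is integer arithmetic. *)
move: (size_det_system_mx p_neq0) (size_det_system_mx_shift p_neq0) p_gt0.
move: (size _) => m [le_m eq_m] shift m_gt0.
split=> [full|d le_dr def_d|CB0]; first by have := eq_m full; lia.
  by move: le_m; rewrite def_d; lia.
have {shift} [le_m' eq_m'] := shift CB0.
(* The bound n - 2r - (r - rank(CAB)) equals n - 3r + rank(CAB), and rank(CAB) is l in case 3.3 and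
   l - dbar in case 3.4. The inequality [le_r] keeps the truncated subtraction exact. *)
have le_r := rank_leq_row (C *m A *m B).
split=> [_ full|dbar _ _ -> _|lt_lr def_l|dbar lt_lr lt_l ->];
  first by have := eq_m' full; lia.
- move: le_m' le_r; move: (\rank _) => k; lia.
- move: le_m' le_r; rewrite def_l; lia.
- move: le_m' le_r lt_l; move: (\rank (C *m _ *m _)) => k; lia.
Qed.
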